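(* Let $G=(V,E)$ be a graph and let $\mu$ be a measure on $V$. Then $\mu$ is balanced if and only if $\mu$ is a convex combination of compatible basic balanced measures, i.e. if and only if there exist $N\ge 1$, a compatible family $\{\mu_1,\dots,\mu_N\}$ of basic balanced measures on $G$, and reals $a_1,\dots,a_N\ge 0$ with $\sum_{i=1}^N a_i=1$ such that $\mu=\sum_{i=1}^N a_i\mu_i$.
   Context: Every graph is finite, connected and simple with unit edge weights; $d(u,v)$ is the graph distance. ''Measure'' means probability measure on $V$, identified with a function $\mu:V\to\mathbb{R}_{\ge 0}$ with $\sum_{v\in V}\mu(v)=1$. The support is $\operatorname{spt}\mu=\{v\in V:\mu(v)>0\}$. The transport cost function is $T_\mu(v)=\sum_{u\in V}d(u,v)\mu(u)$, and the cost-maximizing set is $M_\mu=\{v\in V: T_\mu(v)=\max_{u\in V}T_\mu(u)\}$. A probability measure $\mu$ is balanced if $\operatorname{spt}\mu\subseteq M_\mu$. A probability measure $\mu$ is basic if for every probability measure $\nu\ne\mu$ on $V$ at least one of $\operatorname{spt}\mu\neq\operatorname{spt}\nu$ or $M_\mu\ne M_\nu$ holds. A family $\{\mu_\alpha\}_{\alpha\in I}$ of probability measures is compatible if $\bigcup_{\alpha\in I}\operatorname{spt}\mu_\alpha\subseteq\bigcap_{\alpha\in I}M_{\mu_\alpha}$. *)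

(* Defs.v *)
From HB Require Import structures.
From mathcomp Require Import all_boot all_order all_algebra.
From mathcomp Require Import reals.

Set Implicit Arguments.
Unset Strict Implicit.
Unset Printing Implicit Defensive.

Import Order.TTheory GRing.Theory Num.Theory.
Local Open Scope ring_scope.

Record graph := Graph {
  vertex :> finType;
  adj : rel vertex;
  adj_sym : symmetric adj;
  adj_irrefl : irreflexive adj;
  adj_connected : forall u v, connect adj u v
}.

Definition has_walk (G : graph) (u v : G) (n : nat) : bool :=
  [exists p : n.-tuple G, path (@adj G) u p && (last u p == v)].

Lemma has_walk_ex (G : graph) (u v : G) : exists n, has_walk u v n.
Proof.
have /connectP[p up ->] := adj_connected u v.
by exists (size p); apply/existsP; exists (in_tuple p); rewrite up eqxx.
Qed.

Definition dist (G : graph) (u v : G) : nat := ex_minn (has_walk_ex u v).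

Section Measures.
Variables (R : realType) (G : graph).
Implicit Types mu nu : {ffun G -> R}.

Definition prob_measure mu : Prop :=
  (forall v, 0 <= mu v) /\ \sum_(v : G) mu v = 1.

Definition spt mu : {set G} := [set v | 0 < mu v].

Definition cost mu (v : G) : R := \sum_(u : G) (dist u v)%:R * mu u.

(* Taking [cost mu v], itself one of the values compared, as the default of
   the big maximum makes it the maximum of [cost mu] over all vertices. *)
Definition costmax mu : {set G} :=
  [set v | cost mu v == \big[Num.max/cost mu v]_(u : G) cost mu u].

Definition balanced mu : Prop := spt mu \subset costmax mu.

Definition basic mu : Prop :=
  forall nu, prob_measure nu -> nu <> mu ->
    spt mu <> spt nu \/ costmax mu <> costmax nu.

Definition compatible (I : finType) (mus : I -> {ffun G -> R}) : Prop :=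
  \bigcup_(i : I) spt (mus i) \subset \bigcap_(i : I) costmax (mus i).

End Measures.

(* Main.v *)
Require Import Defs.
From mathcomp Require Import all_boot all_order all_algebra.
From mathcomp Require Import reals.
From mathcomp Require Import boolp ring.
Import Order.TTheory GRing.Theory Num.Theory.
Local Open Scope ring_scope.

(** Fix a vertex [m] of the graph. The probability measures whose cost is maximal
    at [m] form a polytope: they are cut out of the hyperplane of total mass 1 by
    the linear inequalities [0 <= mu v] and [cost mu u <= cost mu m]. The inequalities that
    are tight at [mu] record exactly the complement of [spt mu] and the set
    [costmax mu], so two measures have the same support and the same
    cost-maximizing set precisely when they lie in the relative interior of the
    same face, and its basic measures are the extreme points of the polytope.
    The theorem is thus the fact that a point of a polytope is a convex
    combination of extreme points of the face in which it lies
    ([basic_decomposition]).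

    This is proved by induction on the number of inequalities that are not tight.
    If [mu] is not basic, some [nu <> mu] lies in the interior of the same face;
    the line through [mu] and [nu] stays in that face until a new inequality
    becomes tight, and this happens on both sides of [mu] because two distinct
    measures of equal mass cannot be comparable pointwise ([exit_face]). Then [mu]
    lies between the two exit points, which have fewer strict inequalities.

    Every basic measure [rho] so obtained satisfies [spt rho \subset spt mu] and
    [costmax mu \subset costmax rho]. If [mu] is balanced, then for any two of
    them [spt rho \subset spt mu \subset costmax mu \subset costmax rho'], which
    is at once the balance of each and the compatibility of the family. The
    converse holds because [cost] is linear: a vertex of the graph that maximizes
    the cost of every member of the family maximizes the cost of the mixture
    ([balanced_comb]). *)

(** * Cost-maximizing vertices *)

Section Decomposition.
Set Implicit Arguments.
Unset Strict Implicit.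

Variables (R : realType) (G : graph).
Implicit Types (mu nu rho : {ffun G -> R}) (m u v : G).

Lemma in_spt mu v : (v \in spt mu) = (0 < mu v).
Proof. by rewrite inE. Qed.

Lemma costmaxP mu v :
  reflect (forall u, cost mu u <= cost mu v) (v \in costmax mu).
Proof.
rewrite inE; apply: (iffP eqP) => [-> u | maxv].
  exact: le_bigmax.
by apply/le_anti; rewrite bigmax_ge_id bigmax_le.
Qed.

Lemma costmax_exists mu v : exists m, m \in costmax mu.
Proof.
have [m _ maxm] := @arg_maxP _ _ _ v predT (cost mu) isT.
by exists m; apply/costmaxP => u; exact: maxm.
Qed.

Lemma cost_comb (N : nat) (mus : 'I_N -> {ffun G -> R}) (a : 'I_N -> R) mu :
  (forall v, mu v = \sum_(i < N) a i * mus i v) ->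
  forall v, cost mu v = \sum_(i < N) a i * cost (mus i) v.
Proof.
move=> muE v; rewrite /cost.
under eq_bigr do rewrite muE mulr_sumr.
rewrite exchange_big; apply: eq_bigr => i _.
by rewrite mulr_sumr; apply: eq_bigr => u _; rewrite mulrCA.
Qed.

(** * Convex combinations *)

Definition convex_comb (P : {ffun G -> R} -> Prop) mu : Prop :=
  exists (N : nat) (mus : 'I_N -> {ffun G -> R}) (a : 'I_N -> R),
    [/\ (1 <= N)%N, (forall i, P (mus i)),
        (forall i, 0 <= a i) /\ \sum_(i < N) a i = 1
      & forall v, mu v = \sum_(i < N) a i * mus i v].

Lemma convex_comb_self (P : {ffun G -> R} -> Prop) mu : P mu -> convex_comb P mu.
Proof.
move=> Pmu; exists 1%N, (fun=> mu), (fun=> 1); split => //.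
  by split=> [_|]; rewrite ?big_ord1 ?ler01.
by move=> v; rewrite big_ord1 mul1r.
Qed.

Lemma convex_comb_mix (P : {ffun G -> R} -> Prop) (p q : R) mu nu rho :
  0 <= p -> 0 <= q -> p + q = 1 ->
  (forall v, mu v = p * nu v + q * rho v) ->
  convex_comb P nu -> convex_comb P rho -> convex_comb P mu.
Proof.
move=> p0 q0 pq muE [N1 [f [a [N1_gt0 Pf [a0 a1] nuE]]]].
move=> [N2 [g [b [_ Pg [b0 b1] rhoE]]]].
exists (N1 + N2)%N,
  (fun k => match split k with inl i => f i | inr j => g j end),
  (fun k => match split k with inl i => p * a i | inr j => q * b j end).
split.
- by rewrite addn_gt0 N1_gt0.
- by move=> k; case: (split k).
- split; first by move=> k; case: (split k) => i; rewrite mulr_ge0.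
  rewrite big_split_ord /=.
  under eq_bigr do rewrite -[lshift _ _]/(unsplit (inl _)) unsplitK.
  under [X in _ + X]eq_bigr do rewrite -[rshift _ _]/(unsplit (inr _)) unsplitK.
  by rewrite -!mulr_sumr a1 b1 !mulr1.
- move=> v; rewrite big_split_ord /= muE nuE rhoE !mulr_sumr.
  congr (_ + _); apply: eq_bigr => i _.
    by rewrite -[lshift _ _]/(unsplit (inl _)) unsplitK mulrA.
  by rewrite -[rshift _ _]/(unsplit (inr _)) unsplitK mulrA.
Qed.

Lemma convex_comb_sub (P Q : {ffun G -> R} -> Prop) mu :
  (forall nu, P nu -> Q nu) -> convex_comb P mu -> convex_comb Q mu.
Proof.
by move=> PQ [N [f [a [N0 Pf a01 muE]]]]; exists N, f, a; split=> // i; exact: PQ.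
Qed.

(** * The ratio test *)

(** Moving away from a point with slacks [x] in a direction [y], the first
    inequality to become tight is one that minimizes the ratio [x j / - y j]
    over the decreasing slacks. Tight slacks are assumed constant along the
    direction, so that the step is positive. *)
Lemma ratio_test (J : finType) (x y : J -> R) :
  (forall j, 0 <= x j) -> (forall j, x j = 0 -> y j = 0) ->
  (exists j, y j < 0) ->
  exists2 s, 0 < s &
    (forall j, 0 <= x j + s * y j) /\ (exists2 j, 0 < x j & x j + s * y j = 0).
Proof.
move=> x0 xy0 [j0 yj0].
have x_gt0 j : y j < 0 -> 0 < x j.
  by move=> yj; rewrite lt_def x0 andbT; apply: contraTneq yj => /xy0->; rewrite ltxx.
have [j yj minj] := @arg_minP _ _ _ j0 (fun j => y j < 0) (fun j => x j / - y j) yj0.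
exists (x j / - y j); first by rewrite divr_gt0 ?oppr_gt0 ?x_gt0.
split; last first.
  exists j; first exact: x_gt0.
  by rewrite invrN mulrN mulNr divfK ?subrr // lt_eqF.
move=> k; have [yk|yk] := ltP (y k) 0.
  have := minj k yk; rewrite ler_pdivlMr ?oppr_gt0 // mulrN => h.
  by rewrite -[_ * y k]opprK subr_ge0.
by rewrite addr_ge0 // mulr_ge0 // divr_ge0 // oppr_ge0 ltW.
Qed.

(** * The polytope of measures with a given cost-maximizing vertex *)

Definition slack m mu (j : G + G) : R :=
  match j with inl v => mu v | inr u => cost mu m - cost mu u end.

Definition loose m mu : {set G + G} := [set j | 0 < slack m mu j].

Definition line mu nu (t : R) : {ffun G -> R} :=
  [ffun v => mu v + t * (nu v - mu v)].

Lemma slack_line m mu nu t j :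
  slack m (line mu nu t) j = slack m mu j + t * (slack m nu j - slack m mu j).
Proof.
have costE v : cost (line mu nu t) v = cost mu v + t * (cost nu v - cost mu v).
  rewrite /cost -sumrB mulr_sumr -big_split; apply: eq_bigr => u _.
  by rewrite ffunE /=; ring.
by case: j => v /=; [rewrite ffunE | rewrite !costE; ring].
Qed.

Lemma slack_ge0 m mu j : prob_measure mu -> m \in costmax mu -> 0 <= slack m mu j.
Proof.
by move=> [mu0 _] /costmaxP maxm; case: j => v //=; rewrite subr_ge0.
Qed.

Lemma in_costmax_slack m mu u :
  m \in costmax mu -> (u \in costmax mu) = (slack m mu (inr u) == 0).
Proof.
move=> /costmaxP maxm; rewrite /= subr_eq0; apply/costmaxP/eqP => [maxu | <- //].
by apply/le_anti; rewrite maxu maxm.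
Qed.

Lemma slack_eq0_same_face m mu nu j :
  prob_measure nu -> m \in costmax mu ->
  spt mu = spt nu -> costmax mu = costmax nu ->
  slack m mu j = 0 -> slack m nu j = 0.
Proof.
move=> [nu0 _] mmu eqS eqM; have mnu : m \in costmax nu by rewrite -eqM.
case: j => v.
  move=> /= muv; have : v \notin spt nu by rewrite -eqS in_spt muv ltxx.
  by rewrite in_spt -leNgt => nuv; apply/le_anti; rewrite nuv nu0.
by move/eqP; rewrite -(in_costmax_slack v mmu) eqM (in_costmax_slack v mnu) => /eqP.
Qed.

(** Equality of the total masses makes a coordinate decrease strictly. *)
Lemma prob_measure_lt mu nu :
  prob_measure mu -> prob_measure nu -> nu <> mu -> exists v, nu v < mu v.
Proof.
move=> [_ mu1] [_ nu1] neq; apply: contrapT => nlt; apply: neq.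
have le v : mu v <= nu v by rewrite leNgt; apply/negP => lt; apply: nlt; exists v.
have sum0 : \sum_v (nu v - mu v) = 0 by rewrite sumrB nu1 mu1 subrr.
apply/ffunP => v; apply/eqP; rewrite -subr_eq0; apply/eqP.
by apply: (psumr_eq0P _ sum0) => // u _; rewrite subr_ge0.
Qed.

(** Following the line through two points in the interior of a face, until it
    leaves the polytope, leads to a point of a proper subface. The sign of [c]
    tells on which side of [mu] the line is followed. *)
Lemma exit_face m mu nu (c : R) :
  prob_measure mu -> prob_measure nu -> m \in costmax mu ->
  spt mu = spt nu -> costmax mu = costmax nu ->
  (exists v, c * (nu v - mu v) < 0) ->
  exists2 s, 0 < s & let rho := line mu nu (s * c) in
    [/\ prob_measure rho, spt rho \subset spt mu, costmax mu \subset costmax rho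
      & (#|loose m rho| < #|loose m mu|)%N].
Proof.
move=> pmu pnu mmu eqS eqM [v0 v0neg].
pose x := slack m mu; pose y j := c * (slack m nu j - slack m mu j).
have x0 j : 0 <= x j by exact: slack_ge0.
have xy0 j : x j = 0 -> y j = 0.
  by move=> xj; rewrite /y (slack_eq0_same_face pnu mmu eqS eqM) // [slack m mu j]xj subrr mulr0.
have [|s s0 [ge0 [j xj_gt0 xj0]]] := ratio_test x0 xy0.
  by exists (inl v0).
exists s => // rho.
have rhoE k : slack m rho k = x k + s * y k by rewrite slack_line mulrA.
have rho0 k : x k = 0 -> slack m rho k = 0.
  by move=> xk; rewrite rhoE xk xy0 // mulr0 addr0.
have mrho : m \in costmax rho.
  by apply/costmaxP => u; rewrite -subr_ge0 -[_ - _]/(slack m rho (inr u)) rhoE.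
split.
- split=> [v|]; first by rewrite -[rho v]/(slack m rho (inl v)) rhoE.
  under eq_bigr do rewrite ffunE.
  rewrite big_split -mulr_sumr sumrB /=.
  by case: pmu pnu => _ -> [_ ->]; rewrite subrr mulr0 addr0.
- apply/subsetP => v; rewrite !in_spt; apply: contraTT; rewrite -leNgt => muv.
  rewrite -[rho v]/(slack m rho (inl v)) rho0 ?ltxx //.
  by apply/le_anti; rewrite x0 muv.
- apply/subsetP => u; rewrite (in_costmax_slack u mmu) (in_costmax_slack u mrho).
  by move=> /eqP/rho0->.
- apply: proper_card; apply/properP; split; last first.
    by exists j; rewrite inE // rhoE xj0 ltxx.
  apply/subsetP => k; rewrite !inE => rhok; rewrite lt_def x0 andbT.
  by apply: contraTneq rhok => /rho0->; rewrite ltxx.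
Qed.

(** The two inclusions say that [rho] lies in the face of [mu]. They are
    transitive, so what holds for the faces of the two exit points passes to the
    larger face of [mu]. *)
Lemma basic_decomposition m mu :
  prob_measure mu -> m \in costmax mu ->
  convex_comb (fun rho => [/\ prob_measure rho, basic rho,
    spt rho \subset spt mu & costmax mu \subset costmax rho]) mu.
Proof.
have [n] := ubnP #|loose m mu|; elim: n mu => // n IH mu /ltnSE le_n pmu mmu.
have [bmu|nbmu] := pselect (basic mu).
  exact: convex_comb_self.
have [nu [pnu neq eqS eqM]] : exists nu,
    [/\ prob_measure nu, nu <> mu, spt mu = spt nu & costmax mu = costmax nu].
  apply: contrapT => none; apply: nbmu => nu pnu neq.
  have [eqS|neqS] := pselect (spt mu = spt nu); last by left.
  by right=> eqM; apply: none; exists nu.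
have dec rho : [/\ prob_measure rho, spt rho \subset spt mu,
      costmax mu \subset costmax rho & (#|loose m rho| < #|loose m mu|)%N] ->
    convex_comb (fun rho => [/\ prob_measure rho, basic rho,
      spt rho \subset spt mu & costmax mu \subset costmax rho]) rho.
  move=> [prho sS sM lt_rho].
  have := IH rho (leq_trans lt_rho le_n) prho (subsetP sM _ mmu).
  apply: convex_comb_sub => tau [ptau btau sS' sM'].
  by split=> //; [exact: subset_trans sS' sS | exact: subset_trans sM sM'].
have [|s s0 /dec forward] := exit_face (c := 1) pmu pnu mmu eqS eqM.
  by have [v lt] := prob_measure_lt pmu pnu neq; exists v; rewrite mul1r subr_lt0.
have [|t t0 /dec backward] := exit_face (c := -1) pmu pnu mmu eqS eqM.
  have [v lt] := prob_measure_lt pnu pmu (not_eq_sym neq).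
  by exists v; rewrite mulN1r opprB subr_lt0.
have st0 : 0 < s + t by rewrite addr_gt0.
(* [mu] divides the segment from parameter [s] to parameter [- t] at 0. *)
apply: (@convex_comb_mix _ (t / (s + t)) (s / (s + t)) _ _ _ _ _ _ _ forward backward).
- by rewrite divr_ge0 // ltW.
- by rewrite divr_ge0 // ltW.
- by field; rewrite gt_eqF.
- by move=> v; rewrite !ffunE; field; rewrite gt_eqF.
Qed.

(** * Balanced measures *)

Lemma balanced_comb (N : nat) (mus : 'I_N -> {ffun G -> R}) (a : 'I_N -> R) mu :
  compatible mus -> (forall i, 0 <= a i) ->
  (forall v, mu v = \sum_(i < N) a i * mus i v) -> balanced mu.
Proof.
move=> /subsetP comp a0 muE; apply/subsetP => v; rewrite in_spt => muv.
have /comp/bigcapP maxv : v \in \bigcup_i spt (mus i).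
  apply/bigcupP; apply: contrapT => none.
  suff : mu v <= 0 by rewrite leNgt muv.
  rewrite muE; apply: sumr_le0 => i _; apply: mulr_ge0_le0 => //.
  by rewrite leNgt; apply/negP => lt; apply: none; exists i; rewrite // in_spt.
apply/costmaxP => u; rewrite !(cost_comb muE); apply: ler_sum => i _.
by apply: ler_wpM2l => //; exact/costmaxP/maxv.
Qed.

End Decomposition.

Theorem theorem1p4 (R : realType) (G : graph) (mu : {ffun G -> R})
    (mu_prob : prob_measure mu) :
  balanced mu <->
  exists (N : nat) (mus : 'I_N -> {ffun G -> R}) (a : 'I_N -> R),
    [/\ (1 <= N)%N,
        compatible mus,
        (forall i, [/\ prob_measure (mus i), basic (mus i) & balanced (mus i)]),
        (forall i, 0 <= a i) /\ \sum_(i < N) a i = 1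
      & forall v, mu v = \sum_(i < N) a i * mus i v].
Proof.
split=> [bal | [N [mus [a [_ comp _ [a0 _] muE]]]]]; last first.
  exact: balanced_comb comp a0 muE.
have [v _] : exists v : G, true.
  (* A total mass of 1 rules out the empty vertex set. *)
  apply: contrapT => none; case: mu_prob => _.
  rewrite big1 => [/esym/eqP|v _]; first by rewrite oner_eq0.
  by case: none; exists v.
have [m mmu] := costmax_exists mu v.
have [N [mus [a [N0 face a01 muE]]]] := basic_decomposition mu_prob mmu.
have sub i j : spt (mus i) \subset costmax (mus j).
  have [_ _ sS _] := face i; have [_ _ _ sM] := face j.
  exact: subset_trans sS (subset_trans bal sM).
exists N, mus, a; split=> //.
  by apply/bigcupsP => i _; apply/bigcapsP => j _.
by move=> i; have [] := face i; split=> //; exact: sub.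
Qed.
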